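(* Let $n\geq 3$. For every monic polynomial $p(z)=z^n+\sum_{i=0}^{n-1}a_i z^i\in\mathbb{C}[z]$ with $p(z)\not\equiv z^n$, let $\mu(p):=\max\{|\lambda| : \lambda\in\mathbb{C},\ p(\lambda)=0\}$ (so $\mu(p)>0$), and let $\Gamma(p)$ be the root bound defined in the context. Let $$\Omega_n := \sup\left\{ \frac{\Gamma(p)}{\mu(p)} : p\in\mathbb{C}[z] \text{ monic of degree } n,\ p(z)\not\equiv z^n\right\}$$ be the maximum relative overestimation of $\mu$ by $\Gamma$ in degree $n$. Then: (1) $\Omega_n\leq 1.4655\,n$ for all $n\geq 3$, i.e. $\Gamma(p)\le 1.4655\,n\,\mu(p)$ for all such $p$. (2) For $n\geq 11$, $\Omega_n$ exceeds the lower threshold $\dfrac{1}{\sqrt[n]{2}-1}$ by less than $5$ per cent: $\Omega_n < 1.05\cdot\dfrac{1}{\sqrt[n]{2}-1}$. (3) For $n\geq 85$, $\Omega_n$ exceeds this lower threshold by at most $2$ per cent: $\Omega_n \leq 1.02\cdot\dfrac{1}{\sqrt[n]{2}-1}$.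
   Context: For a monic complex polynomial $p(z)=z^n+\sum_{i=0}^{n-1}a_iz^i$ of degree $n\geq 3$ put $$\tau := \max\left\{ \sqrt[3]{|a_{n-3}|/2.15},\ \sqrt[4]{|a_{n-4}|/2},\ \sqrt[5]{|a_{n-5}|},\ \sqrt[6]{|a_{n-6}|},\ \ldots,\ \sqrt[n]{|a_{0}|}\right\},$$ that is, $\tau=\max_{3\le k\le n} \sqrt[k]{|a_{n-k}|/w_k}$ with $w_3=2.15$, $w_4=2$ and $w_k=1$ for $k\ge 5$, and $$\Gamma(p) := \max\left\{ \sqrt{3.15}\,\sqrt{\tau^2+\max\{|a_{n-2}|,\,2\tau^2\}}\,,\ \ \frac{|a_{n-1}|+\sqrt{|a_{n-1}|^2+4\left(\tau^2+\max\{|a_{n-2}|,\,2.15\,\tau^2\}\right)}}{2}\right\}.$$ All decimals denote exact rational numbers. The relative overestimation of $\mu(p)$ by a root bound $B(p)$ is the quotient $B(p)/\mu(p)$. An absolute root bound is an upper bound for $\mu(p)$ that uses only the absolute values of the coefficients of $p$. The number $1/(\sqrt[n]{2}-1)$ is called the lower threshold because, by a known result of van der Sluis, it is the smallest possible worst-case relative overestimation in degree $n$ among all absolute root bounds. *)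

(* Defs.v *)
From HB Require Import structures.
From mathcomp Require Import all_boot all_order all_algebra.
From mathcomp Require Import complex.
From mathcomp Require Import all_classical all_reals all_analysis.

Set Implicit Arguments.
Unset Strict Implicit.
Unset Printing Implicit Defensive.

Import Order.TTheory GRing.Theory Num.Theory.

Local Open Scope classical_set_scope.
Local Open Scope ring_scope.

Section RootBound.
Variable R : realType.
Implicit Types (p : {poly R[i]}) (n k : nat).

(* The modulus valued in R; the norm `|z| of R[i] is valued in R[i]. *)
Definition modulus (z : R[i]) : R := Normc.normc z.

(* [nthroot k x] is only used for [0 < k] and [0 <= x], where [powR] is the
   usual real k-th root (in particular [powR 0 k%:R^-1 = 0]). *)
Definition nthroot k (x : R) : R := x `^ k%:R^-1.

Definition degree p : nat := (size p).-1.

Definition monic_nontrivial n p : Prop :=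
  [/\ p \is monic, size p = n.+1 & p != 'X^n].

(* For p nonconstant the set of moduli of roots is finite and nonempty, so
   that this supremum is a maximum. *)
Definition mu p : R := sup [set modulus z | z in [set z | root p z]].

Definition weight k : R :=
  if k == 3%N then 215 / 100 else if k == 4%N then 2 else 1.

(* All the terms are nonnegative, so the default value 0 is harmless. *)
Definition tau p : R :=
  \big[Num.max/0]_(3 <= k < (degree p).+1)
     nthroot k (modulus p`_(degree p - k)%N / weight k).

Definition Gamma p : R :=
  let a1 := modulus p`_(degree p - 1)%N in
  let a2 := modulus p`_(degree p - 2)%N in
  let t := tau p in
  Num.max
    (Num.sqrt (315 / 100) * Num.sqrt (t ^+ 2 + Num.max a2 (2 * t ^+ 2)))
    ((a1 + Num.sqrt (a1 ^+ 2
                     + 4 * (t ^+ 2 + Num.max a2 (215 / 100 * t ^+ 2)))) / 2).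

(* The supremum is taken in the extended reals, since [sup] of an unbounded
   set of reals is 0 by convention. *)
Definition Omega n : \bar R :=
  ereal_sup [set (Gamma p / mu p)%:E | p in monic_nontrivial n].

Definition lower_threshold n : R := (nthroot n 2 - 1)^-1.

End RootBound.

Arguments Omega : clear implicits.
Arguments lower_threshold : clear implicits.

(* Main.v *)
Require Import Defs.
From mathcomp Require Import all_boot all_order all_algebra.
From mathcomp Require Import complex.
From mathcomp Require Import all_classical all_reals all_analysis.
From mathcomp Require Import lra.

Set Implicit Arguments.
Unset Strict Implicit.
Unset Printing Implicit Defensive.

Import Order.TTheory GRing.Theory Num.Theory.

Local Open Scope ring_scope.

(** Write $\mu$ for the largest modulus of a root of $p$ and $N = n\mu$.  By
    Vieta, the coefficients of $p$ are dominated by those of $(z + \mu)^n$, so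
    $|a_{n-k}| \le \binom nk \mu^k \le N^k / k!$ ([modulus_coef_le]).

    The root bound $\Gamma$ is monotone in the moduli of the coefficients, so it
    only remains to evaluate it on these estimates.  Its ingredient $\tau$ is at
    most $N \max_k (k! w_k)^{-1/k}$.  The maximum is attained at $k = 3$, where
    it is $12.9^{-1/3} = 0.426386\dots < c := 753/1766 = 0.426387\dots$ ([tau_le]).  With
    $|a_{n-2}| \le N^2/2$, which also dominates $2\tau^2$ and $2.15\tau^2$, the
    first term of $\Gamma$ is at most $\sqrt{3.15(c^2 + 1/2)}\,N < 1.4655\,N$
    and the second one at most
    $(1 + \sqrt{1 + 4(c^2 + 1/2)})N/2 < 1.4655\,N$ ([Gamma_le]).

    Both comparisons with the lower threshold follow from this linear bound.
    Indeed $n/y < 1/(\sqrt[n]2 - 1)$ says that $2 < (1 + y/n)^n$; the right-hand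
    side is nondecreasing in $n$ by the inequality between the arithmetic and
    geometric means ([compound_le]), so it suffices to check it at one degree
    ([lower_threshold_gt]): $n = 11$ for $y = 1.05/1.4655$, and $n = 85$ for
    $y = 1.02/1.4655$. *)

(** * Coefficients of a product of linear factors *)

(* Otherwise simplification unfolds the moduli of the constants 0 and 1. *)
#[local] Arguments modulus : simpl never.

Section Modulus.
Variable R : realType.
Implicit Types (x y z : R[i]) (r : seq R[i]) (M : R).

Lemma modulus_ge0 z : 0 <= modulus z.
Proof. by case: z => a b; exact: sqrtr_ge0. Qed.

Lemma modulusM x y : modulus (x * y) = modulus x * modulus y.
Proof. exact: Normc.normcM. Qed.

Lemma modulusB x y : modulus (x - y) <= modulus x + modulus y.
Proof.
rewrite -[modulus y]normcN; exact: (@le_normcD R x (- y)).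
Qed.

(** Multiplying by $z - a$ turns two neighbouring coefficients $q_j$, $q_{j+1}$
    into $q_j - a q_{j+1}$; the triangle inequality then makes the bounds obey
    Pascal's rule. *)
Lemma modulus_coef_prod_XsubC r M j : (forall z, z \in r -> modulus z <= M) ->
  modulus (\prod_(z <- r) ('X - z%:P))`_j
    <= M ^+ (size r - j) * 'C(size r, j)%:R.
Proof.
elim: r j => [|a r IHr] j rM.
  rewrite big_nil coef1 sub0n expr0 mul1r bin0n.
  case: j => [|j]; first by rewrite eqxx [modulus _]Normc.normc1.
  by rewrite [modulus _]Normc.normc0.
have {}IHr k := IHr k (fun z zr => rM z (mem_behead (s := a :: r) zr)).
have aM : modulus a <= M by apply: rM; rewrite mem_head.
have M0 : 0 <= M := le_trans (modulus_ge0 a) aM.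
rewrite big_cons mulrBl coefB coefXM coefCM.
apply: le_trans (modulusB _ _) _; rewrite modulusM.
case: j => [|j] /=.
  rewrite [modulus 0]Normc.normc0 add0r !subn0 !bin0 !mulr1 exprS.
  apply: ler_pM; rewrite ?modulus_ge0 //.
  by have := IHr 0%N; rewrite subn0 bin0 mulr1.
rewrite subSS binS natrD mulrDr addrC lerD ?IHr //.
have [jr|jr] := ltnP j (size r).
  rewrite -[(size r - j)%N]prednK ?subn_gt0 // -subnS exprS -mulrA.
  by apply: ler_pM; rewrite ?modulus_ge0 ?IHr.
rewrite bin_small // mulr0.
by have := IHr j.+1; rewrite bin_small // mulr0 => /(ler_pM (modulus_ge0 _)
  (modulus_ge0 _) aM); rewrite mulr0.
Qed.

End Modulus.

Lemma ffact_le_expn n k : (n ^_ k <= n ^ k)%N.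
Proof.
by elim: k => // k IHk; rewrite ffactnSr expnSr leq_mul ?leq_subr.
Qed.

(** * The largest modulus of a root *)

Section Roots.
Variables (R : realType) (n : nat) (p : {poly R[i]}).
Hypothesis hp : monic_nontrivial n p.

Lemma monic_nontrivial_split :
  exists2 r : seq R[i], size r = n & p = \prod_(z <- r) ('X - z%:P).
Proof.
have [/monicP p1 sp _] := hp.
have [r pr] := closed_field_poly_normal p.
rewrite p1 scale1r in pr; exists r => //.
by move: sp; rewrite {1}pr size_prod_XsubC => -[].
Qed.

Lemma degreeE : degree p = n.
Proof. by have [_ sp _] := hp; rewrite /degree sp. Qed.

(** A polynomial has finitely many roots, so the supremum defining [mu] is
    taken over a bounded set. *)
Lemma modulus_root_le z : root p z -> modulus z <= mu p.
Proof.
move=> pz; apply: ub_le_sup; last by exists z.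
have [r _ pr] := monic_nontrivial_split.
exists (\sum_(y <- r) modulus y) => _ [y /= + <-].
rewrite pr root_prod_XsubC => yr.
rewrite (big_rem y) //= lerDl.
by apply: sumr_ge0 => i _; exact: modulus_ge0.
Qed.

(** If all roots vanish, the factorization reads $p = z^n$. *)
Lemma mu_gt0 : 0 < mu p.
Proof.
have [_ _ /eqP pX] := hp; have [r sr pr] := monic_nontrivial_split.
have [/hasP[z zr z0]|/hasPn r0] := boolP (has (fun z => z != 0) r).
  have /modulus_root_le : root p z by rewrite pr root_prod_XsubC.
  apply: lt_le_trans.
  rewrite lt_def modulus_ge0 andbT.
  by apply: contra z0 => /eqP/Normc.eq0_normc ->.
case: pX; rewrite pr -sr.
transitivity (\prod_(z <- r) 'X : {poly R[i]}); last first.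
  by rewrite big_const_seq count_predT iter_mulr_1.
rewrite big_seq [RHS]big_seq; apply: eq_bigr => z /r0.
by rewrite negbK => /eqP ->; rewrite subr0.
Qed.

Lemma modulus_coef_le k : (k <= n)%N ->
  modulus p`_(n - k)%N <= (n%:R * mu p) ^+ k / k`!%:R.
Proof.
move=> kn; have [r sr pr] := monic_nontrivial_split.
have rmu z : z \in r -> modulus z <= mu p.
  by move=> zr; apply: modulus_root_le; rewrite pr root_prod_XsubC.
have := modulus_coef_prod_XsubC (n - k)%N rmu.
rewrite -pr sr subKn // bin_sub // => /le_trans; apply.
rewrite ler_pdivlMr ?ltr0n ?fact_gt0 // -mulrA -natrM bin_ffact exprMn mulrC.
by rewrite ler_wpM2r ?exprn_ge0 ?(ltW mu_gt0) // -natrX ler_nat ffact_le_expn.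
Qed.

End Roots.

(** * The root bound *)

Section RootBound.
Variable R : realType.

Lemma nthroot_le k (x y : R) : (0 < k)%N -> 0 <= x -> 0 <= y ->
  x <= y ^+ k -> Defs.nthroot k x <= y.
Proof.
move=> k0 x0 y0 xy; rewrite /Defs.nthroot.
have -> : y = (y ^+ k) `^ k%:R^-1.
  by rewrite -powR_mulrn // -powRrM mulfV ?powRr1 // pnatr_eq0 -lt0n.
by apply: ge0_ler_powR; rewrite ?nnegrE ?invr_ge0 ?ler0n ?exprn_ge0.
Qed.

(** This is $(k! w_k)^{-1/k} \le c$.  The fraction $c = 753/1766$ lies in the
    narrow window between $12.9^{-1/3} = 0.4263864\dots$, required by $k = 3$, and
    $\sqrt{1.4655^2/3.15 - 1/2} = 0.4263876\dots$, allowed by [Gamma_le].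
    From $k = 5$ on, passing from $k$ to $k + 1$ multiplies the left-hand side
    by $c(k + 1) > 1$. *)
Lemma weighted_fact_ge1 k : (3 <= k)%N ->
  1 <= (753 / 1766) ^+ k * weight R k * k`!%:R.
Proof.
case: k => [|[|[|[|[|k]]]]] // _.
- by rewrite [weight R 3](_ : _ = 215 / 100) // (_ : 3`! = 6)%N //; lra.
- by rewrite [weight R 4](_ : _ = 2) // (_ : 4`! = 24)%N //; lra.
have -> : weight R k.+4.+1 = 1 by [].
rewrite mulr1.
elim: k => [|k IHk]; first by rewrite (_ : 5`! = 120)%N //; lra.
rewrite factS natrM exprS mulrACA.
have : (3 : R) <= k.+1.+4.+1%:R by rewrite ler_nat.
by move=> k3; rewrite -[leLHS]mulr1; apply: ler_pM => //; lra.
Qed.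

Lemma weight_gt0 k : 0 < weight R k.
Proof. by rewrite /weight; do 2?case: ifP => _; lra. Qed.

Lemma tau_ge0 (p : {poly R[i]}) : 0 <= tau p.
Proof.
rewrite /tau; elim/big_ind: _ => // [x y x0 y0|i _].
- by rewrite le_max x0.
- exact: powR_ge0.
Qed.

Lemma tau_le n (p : {poly R[i]}) : monic_nontrivial n p ->
  tau p <= 753 / 1766 * (n%:R * mu p).
Proof.
move=> hp; have c0 : 0 <= 753 / 1766 :> R by lra.
(* Generalizing over the fraction keeps its unary numerals from being computed. *)
move: (753 / 1766) c0 weighted_fact_ge1 => c c0 cw.
set N := n%:R * mu p.
have N0 : 0 <= N by rewrite mulr_ge0 ?ler0n ?(ltW (mu_gt0 hp)).
rewrite /tau (degreeE hp) big_seq_cond; apply: bigmax_le.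
  exact: mulr_ge0.
move=> k; rewrite andbT mem_index_iota ltnS => /andP[k3 kn].
have w0 := weight_gt0 k.
apply: nthroot_le; rewrite ?(leq_trans _ k3) //.
- by rewrite divr_ge0 ?modulus_ge0 ?ltW.
- exact: mulr_ge0.
rewrite ler_pdivrMr //; apply: le_trans (modulus_coef_le hp kn) _; rewrite -/N.
rewrite ler_pdivrMr ?ltr0n ?fact_gt0 // [(c * N) ^+ k]exprMn.
rewrite !(mulrAC _ (N ^+ k)).
by rewrite -[leLHS]mul1r ler_wpM2r ?exprn_ge0 ?cw.
Qed.

(** The constant $1.4655$ is sharp to the last digit: for $n \to \infty$ and
    $p = (z + 1)^n$ the first term of [Gamma] is $1.46549\dots n$, and the second
    one is estimated through $\sqrt{1 + 4(c^2 + 1/2)} \le 1.931$. *)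
Lemma Gamma_le n (p : {poly R[i]}) : (3 <= n)%N -> monic_nontrivial n p ->
  Gamma p <= 14655 / 10000 * n%:R * mu p.
Proof.
move=> n3 hp; rewrite -mulrA.
have := tau_le hp; have := tau_ge0 p.
have := modulus_coef_le hp (leq_trans (isT : 1 <= 3)%N n3).
have := modulus_coef_le hp (leq_trans (isT : 2 <= 3)%N n3).
rewrite (_ : 2`! = 2)%N // (_ : 1`! = 1)%N // divr1 expr1 /Gamma (degreeE hp).
have := modulus_ge0 p`_(n - 1)%N.
have := modulus_ge0 p`_(n - 2)%N.
have : 0 <= n%:R * mu p by rewrite mulr_ge0 ?ler0n ?(ltW (mu_gt0 hp)).
move: (n%:R * mu p) (modulus p`_(n - 1)%N) (modulus p`_(n - 2)%N) (tau p).
move=> N a1 a2 t N0 a2_ge0 a1_ge0 a2N a1N t0 tN.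
have t2N : t ^+ 2 <= (753 / 1766) ^+ 2 * N ^+ 2.
  by rewrite -exprMn !expr2; exact: ler_pM.
have NN0 : 0 <= N ^+ 2 by exact: sqr_ge0.
have sqrt_le (x y : R) : 0 <= y -> x <= y ^+ 2 -> Num.sqrt x <= y.
  by move=> y0 xy; rewrite -[y]ger0_norm // -sqrtr_sqr ler_wsqrtr.
have max_le b : 2 <= b -> b <= 215 / 100 ->
    Num.max a2 (b * t ^+ 2) <= N ^+ 2 / 2.
  by move=> b2 b215; rewrite ge_max a2N /=; nra.
have m1 := max_le 2 (lexx _) ltac:(lra).
have m2 := max_le (215 / 100) ltac:(lra) (lexx _).
rewrite ge_max; apply/andP; split.
  rewrite -sqrtrM; last by lra.
  by apply: sqrt_le; [lra|rewrite exprMn; lra].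
have : Num.sqrt (a1 ^+ 2 + 4 * (t ^+ 2 + Num.max a2 (215 / 100 * t ^+ 2)))
    <= 1931 / 1000 * N.
  have a1N2 : a1 ^+ 2 <= N ^+ 2 by rewrite lerXn2r ?nnegrE.
  by apply: sqrt_le; [lra|rewrite exprMn; lra].
by lra.
Qed.

End RootBound.

(** * The lower threshold *)

Section LowerThreshold.
Variable R : realType.

(** The inequality between the arithmetic and geometric means, applied to the
    number $1$ and $n$ copies of $1 + y/n$. *)
Lemma compound_le_succ n (y : R) : (0 < n)%N -> 0 <= y ->
  (1 + y / n%:R) ^+ n <= (1 + y / n.+1%:R) ^+ n.+1.
Proof.
move=> n0 y0; set a := 1 + y / n%:R.
have a0 : 0 <= a by rewrite addr_ge0 ?divr_ge0 ?ler0n.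
pose E (i : 'I_n.+1) := if i == ord0 then 1 else a.
have [+ _] := @leif_AGM R 'I_n.+1 predT E ltac:(by move=> i _; rewrite /E; case: ifP).
rewrite big_ord_recl [\sum_(_ in _) _]big_ord_recl /= mul1r.
rewrite prodr_const sumr_const !card_ord => /le_trans; apply.
rewrite le_eqVlt; apply/orP; left; apply/eqP; congr (_ ^+ _).
have n0' : n%:R != 0 :> R by rewrite pnatr_eq0 -lt0n.
have n1' : n.+1%:R != 0 :> R by rewrite pnatr_eq0.
have -> : a *+ n = n%:R + y by rewrite -[LHS]mulr_natr mulrDl mul1r divfK.
by rewrite addrA nat1r mulrDl divff.
Qed.

Lemma compound_le m n (y : R) : (0 < m)%N -> (m <= n)%N -> 0 <= y ->
  (1 + y / m%:R) ^+ m <= (1 + y / n%:R) ^+ n.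
Proof.
move=> m0 mn y0; elim: n mn => [|n IHn]; first by rewrite leqNgt m0.
rewrite leq_eqVlt => /orP[/eqP <- //|mn].
exact: le_trans (IHn mn) (compound_le_succ (leq_trans m0 mn) y0).
Qed.

Lemma nthroot_expn k (x : R) : (0 < k)%N -> 0 <= x -> Defs.nthroot k x ^+ k = x.
Proof.
move=> k0 x0; rewrite -powR_mulrn ?powR_ge0 // -powRrM mulVf ?powRr1 //.
by rewrite pnatr_eq0 -lt0n.
Qed.

Lemma lower_threshold_gt m n (y : R) : (0 < m)%N -> (m <= n)%N -> 0 < y ->
  2 < (1 + y / m%:R) ^+ m -> n%:R / y < lower_threshold R n.
Proof.
move=> m0 mn y0 ym; have n0 := leq_trans m0 mn.
have rn : Defs.nthroot n (2 : R) ^+ n = 2 by apply: nthroot_expn => //; lra.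
have r0 : 0 <= Defs.nthroot n (2 : R) by exact: powR_ge0.
have r1 : 1 < Defs.nthroot n (2 : R).
  by rewrite -(ltr_pXn2r n0) ?nnegrE // rn expr1n; lra.
have yn0 : 0 <= y / n%:R by rewrite divr_ge0 ?ler0n ?ltW.
have ry : Defs.nthroot n (2 : R) < 1 + y / n%:R.
  rewrite -(ltr_pXn2r n0) ?nnegrE ?addr_ge0 // rn.
  exact: lt_le_trans ym (compound_le m0 mn (ltW y0)).
rewrite /lower_threshold -invf_div ltf_pV2 ?posrE ?subr_gt0 ?divr_gt0 ?ltr0n //.
by rewrite ltrBlDl.
Qed.

End LowerThreshold.

Theorem theorem3p1 (R : realType) (n : nat) (hn : (3 <= n)%N) :
  (forall p : {poly R[i]}, monic_nontrivial n p -> 0 < mu p) /\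
  ((Omega R n <= (14655 / 10000 * n%:R)%:E)%E /\
   (forall p : {poly R[i]}, monic_nontrivial n p ->
      Gamma p <= 14655 / 10000 * n%:R * mu p)) /\
  ((11 <= n)%N ->
     (Omega R n < (105 / 100 * lower_threshold R n)%:E)%E) /\
  ((85 <= n)%N ->
     (Omega R n <= (102 / 100 * lower_threshold R n)%:E)%E).
Proof.
have Omega_le : (Omega R n <= (14655 / 10000 * n%:R)%:E)%E.
  apply: ge_ereal_sup => _ [p hp <-].
  by rewrite lee_fin ler_pdivrMr ?(mu_gt0 hp) // Gamma_le.
split; first by move=> p; exact: mu_gt0.
split; first by split=> // p; exact: Gamma_le.
split=> hm.
  apply: le_lt_trans Omega_le _; rewrite lte_fin.
  have := @lower_threshold_gt R 11 n (10500 / 14655) isT hm ltac:(lra) ltac:(lra).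
  by lra.
apply: le_trans Omega_le _; rewrite lee_fin.
have := @lower_threshold_gt R 85 n (10200 / 14655) isT hm ltac:(lra) ltac:(lra).
by lra.
Qed.
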